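(* Let $S : X \to X$, $X = \Sigma_M^+ \times \widehat{\mathbb{C}}$, be the skew-product map associated with rational maps $R_1, \dots, R_M$ of the Riemann sphere, at least one of which has degree at least $2$. Let $f : X \to \mathbb{R}$ be a function. Suppose there exists a constant $\lambda_f > 1$ such that $E_S(f,n) \asymp (\lambda_f)^n$, i.e. there exist constants $\kappa_1, \kappa_2 > 0$ with $\kappa_1 \lambda_f^n \le E_S(f,n) \le \kappa_2 \lambda_f^n$ for all integers $n \ge 1$. Then $$\pi_S(f,N) = \sum_{1 \le n \le N} C_S(f,n) \asymp \frac{(\lambda_f)^N}{N},$$ i.e. there exist constants $\sigma_1, \sigma_2 > 0$ such that $\sigma_1 \lambda_f^N / N \le \pi_S(f,N) \le \sigma_2 \lambda_f^N / N$ for all integers $N \ge 1$.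
   Context: Let $R_1, \dots, R_M$ be finitely many rational maps acting on the Riemann sphere $\widehat{\mathbb{C}} = \mathbb{C} \cup \{\infty\}$, of degrees $r_1, \dots, r_M$ respectively, with at least one of the degrees at least $2$. Let $\Sigma_M^+$ be the set of infinite words $\omega = (\omega_1 \omega_2 \cdots)$ with letters in $\{1, \dots, M\}$, and let $\sigma$ be the shift, $(\sigma\omega)_j = \omega_{j+1}$ for $j \ge 1$. The skew-product map $S : X \to X$, $X = \Sigma_M^+ \times \widehat{\mathbb{C}}$, is $S(\omega, z_0) = (\sigma\omega, R_{\omega_1} z_0)$. For an integer $n \ge 1$, $\mathrm{Per}_n(S)$ is the set of points $p \in X$ with $S^n p = p$; the prime period $n_p$ of a periodic point $p$ is the least positive integer $m$ with $S^m p = p$. $\mathscr{O}_n(S)$ denotes the collection of all closed orbits of length $n$, i.e. sets $\tau = \{p, Sp, \dots, S^{n-1}p\}$ where $p$ is a periodic point with prime period exactly $n$. For $f : X \to \mathbb{R}$ the $n$-th ergodic sum is $f^n(p) = \sum_{j=0}^{n-1} f(S^j p)$, and for $\tau = \{p, Sp, \dots, S^{n-1}p\} \in \mathscr{O}_n(S)$ one puts $f^n(\tau) = f^n(p)$ (independent of the choice of $p \in \tau$). Define $$E_S(f,n) = \sum_{p \in \mathrm{Per}_n(S)} e^{f^{n_p}(p)}, \qquad C_S(f,n) = \sum_{\tau \in \mathscr{O}_n(S)} e^{f^n(\tau)}, \qquad \pi_S(f,N) = \sum_{1 \le n \le N} C_S(f,n).$$ Sums of positive terms are understood a priori with values in $[0,\infty]$.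 *)

(* Defs.v *)
From HB Require Import structures.
From mathcomp Require Import all_boot all_order all_algebra.
From mathcomp Require Import complex.
From mathcomp Require Import all_classical all_reals all_analysis.

Set Implicit Arguments.
Unset Strict Implicit.
Unset Printing Implicit Defensive.

Import Order.TTheory GRing.Theory Num.Theory.
Local Open Scope classical_set_scope.
Local Open Scope ring_scope.
Local Open Scope complex_scope.

(* [u n \asymp v n] over the positive integers. *)
Definition asymp (R : realType) (u : nat -> \bar R) (v : nat -> R) : Prop :=
  exists k1 k2 : R, [/\ 0 < k1, 0 < k2 &
    forall n : nat, (1 <= n)%N ->
      ((k1 * v n)%:E <= u n)%E /\ (u n <= (k2 * v n)%:E)%E].

Section RiemannSphere.
Variable R : realType.

Definition riemann_sphere : Type := one_point_compactification R[i].

HB.instance Definition _ := Choice.copy riemann_sphere (option R[i]).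

(* The point with homogeneous coordinates [a : b], (a, b) != (0, 0). *)
Definition sphere_point (a b : R[i]) : riemann_sphere :=
  if b == 0 then None else Some (a / b).

(* The quotient num / den in lowest terms. Coprimality excludes (0, 0), but
   allows den = 0 with num a nonzero constant: the constant map oo. *)
Record rational_map := RationalMap {
  rnum : {poly R[i]};
  rden : {poly R[i]};
  rcoprime : coprimep rnum rden }.

Definition rdegree (Q : rational_map) : nat :=
  maxn (size (rnum Q)).-1 (size (rden Q)).-1.

(* At oo, evaluate the homogenizations of rnum Q and rden Q of degree
   rdegree Q at [1 : 0]: only the coefficients of that degree remain. *)
Definition rational_eval (Q : rational_map) (z : riemann_sphere) :
    riemann_sphere :=
  match z with
  | Some w => sphere_point (rnum Q).[w] (rden Q).[w]
  | None => sphere_point (rnum Q)`_(rdegree Q) (rden Q)`_(rdegree Q)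
  end.

End RiemannSphere.

Section Dynamics.
Variables (R : realType) (X : choiceType) (S : X -> X).

Definition Per (n : nat) : set X := [set p | iter n S p = p].

Definition is_prime_period (p : X) (m : nat) : Prop :=
  [/\ (1 <= m)%N, Per m p & forall k, (1 <= k)%N -> Per k p -> (m <= k)%N].

(* The default value 0 is only reached at non-periodic points. *)
Definition prime_period (p : X) : nat := xget 0%N (is_prime_period p).

Definition orbit_segment (n : nat) (p : X) : set X :=
  [set iter j S p | j in `I_n].

Definition closed_orbits (n : nat) : set (set X) :=
  [set orbit_segment n p | p in [set p | is_prime_period p n]].

Definition ergodic_sum (f : X -> R) (n : nat) (p : X) : R :=
  \sum_(0 <= j < n) f (iter j S p).

(* The common value of [ergodic_sum f n] at the points of the closed orbit tau;
   see [orbit_ergodic_sumE]. *)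
Definition orbit_ergodic_sum (f : X -> R) (n : nat) (tau : set X) : R :=
  xget 0 (ergodic_sum f n @` tau).

Lemma ergodic_sum_shift (f : X -> R) (n j : nat) (p : X) :
  Per n p -> ergodic_sum f n (iter j S p) = ergodic_sum f n p.
Proof.
move=> pn; elim: j => // j <-; rewrite iterS; set q := iter j S p.
have qn : iter n S q = q by rewrite /q -iterD addnC iterD pn.
case: n qn {pn} => [|n] qn; first by rewrite /ergodic_sum !big_geq.
rewrite /ergodic_sum big_nat_recr //= [RHS]big_nat_recl //= addrC.
congr (_ + _); first by rewrite -iterSr qn.
by apply: eq_bigr => i _; rewrite -iterSr.
Qed.

Lemma orbit_ergodic_sumE (f : X -> R) (n : nat) (tau : set X) (p : X) :
  closed_orbits n tau -> tau p ->
  orbit_ergodic_sum f n tau = ergodic_sum f n p.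
Proof.
move=> [q [_ qn _] <-] [i ni <-]; apply: xget_unique.
  by exists (iter i S q) => //; exists i.
by move=> y [_ [k _ <-] <-]; rewrite !ergodic_sum_shift.
Qed.

Definition E_sum (f : X -> R) (n : nat) : \bar R :=
  \esum_(p in Per n) (expR (ergodic_sum f (prime_period p) p))%:E.

Definition C_sum (f : X -> R) (n : nat) : \bar R :=
  \esum_(tau in closed_orbits n) (expR (orbit_ergodic_sum f n tau))%:E.

Definition pi_sum (f : X -> R) (N : nat) : \bar R :=
  (\sum_(1 <= n < N.+1) C_sum f n)%E.

End Dynamics.

Section SkewProduct.
Variables (R : realType) (M : nat).

(* Words are indexed from 0: [w j] is the letter omega_(j+1). *)
Definition words : Type := nat -> 'I_M.

HB.instance Definition _ := Choice.copy words (nat -> 'I_M).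

Definition shift (w : words) : words := fun j => w j.+1.

Definition skew_product (Q : 'I_M -> rational_map R)
    (p : words * riemann_sphere R) : words * riemann_sphere R :=
  (shift p.1, rational_eval (Q (p.1 0%N)) p.2).

End SkewProduct.

(* Main.v *)
Require Import Defs.
From mathcomp Require Import all_boot all_order all_algebra.
From mathcomp Require Import all_classical all_reals all_analysis.
From mathcomp Require Import ring lra.

(** The theorem is a counting argument about the periodic orbits of a self-map
    [S] of a set, carried out in that generality in [asymp_pi_sum].

    A periodic point of prime period [d] is fixed by [S ^ n] exactly when
    [d %| n], and the points of prime period [d] are grouped in closed orbits,
    each of which has [d] points sharing the same weight.  Hence
    [E n = \sum_(d | d %| n) d * C d] (lemma [E_sum_divisors]), which is
    compared with [pi N = \sum_(d <= N) C d] in two ways.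

    - Lower bound: every divisor [d] of [N] is at most [N], so
      [E N <= N * pi N]; the hypothesis on [E N] gives what is wanted.
    - Upper bound: keeping only the divisor [d = n] gives [n * C n <= E n], so
      that [C n] is at most a multiple of [lam ^ n / n].  As [lam > 1], the sum
      of these bounds over [n <= N] is of the order of its last term (lemma
      [sum_geometric_over_index_le]).

    All sums are taken in the extended reals, so that the finiteness of [C n]
    is a by-product of the second point. *)

Set Implicit Arguments.
Unset Strict Implicit.
Unset Printing Implicit Defensive.

Import Order.TTheory GRing.Theory Num.Theory.
Local Open Scope classical_set_scope.
Local Open Scope ring_scope.

(** * Periodic orbits of a self-map *)

Section PeriodicOrbits.
Variables (X : choiceType) (S : X -> X).

Lemma iter_modn (d k : nat) (p : X) :
  Per S d p -> iter k S p = iter (k %% d) S p.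
Proof.
move=> pd; rewrite {1}(divn_eq k d) addnC iterD; congr (iter _ S _).
by elim: (k %/ d)%N => // m IH; rewrite mulSn iterD IH.
Qed.

Lemma Per_iter (d j : nat) (p : X) : Per S d p -> Per S d (iter j S p).
Proof. by rewrite /Per /= => pd; rewrite -iterD addnC iterD pd. Qed.

(** On an orbit of period [d], the [j] steps of [S ^ j] are undone by going on
    until [j] full turns are completed. *)
Lemma iter_periodic_inv (d j : nat) (p : X) : (1 <= d)%N -> Per S d p ->
  iter (j * d - j) S (iter j S p) = p.
Proof.
move=> d0 pd; rewrite -iterD subnK ?leq_pmulr//.
by rewrite (iter_modn _ pd) modnMl.
Qed.

Lemma is_prime_period_iter (d j : nat) (p : X) :
  is_prime_period S p d -> is_prime_period S (iter j S p) d.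
Proof.
move=> [d0 pd dmin]; split=> //; first exact: Per_iter.
move=> k k0 /(@Per_iter _ (j * d - j)%N); rewrite iter_periodic_inv//.
exact: dmin.
Qed.

Lemma is_prime_period_unique (p : X) (d e : nat) :
  is_prime_period S p d -> is_prime_period S p e -> d = e.
Proof.
move=> [d0 pd dmin] [e0 pe emin].
by apply/eqP; rewrite eqn_leq dmin// emin.
Qed.

Lemma prime_periodE (p : X) (d : nat) :
  is_prime_period S p d -> prime_period S p = d.
Proof.
by move=> pd; apply: xget_unique => // e /is_prime_period_unique; apply.
Qed.

Lemma is_prime_period_exists (p : X) (n : nat) : (1 <= n)%N -> Per S n p ->
  exists d, is_prime_period S p d.
Proof.
move=> n0 pn.
have ex : exists m, (1 <= m)%N && `[< Per S m p >].
  by exists n; rewrite n0; apply/asboolP.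
case: (ex_minnP ex) => d /andP[d0 /asboolP pd] dmin; exists d; split=> //.
by move=> k k0 pk; apply: dmin; rewrite k0; apply/asboolP.
Qed.

Lemma Per_dvdn (p : X) (d n : nat) : is_prime_period S p d ->
  Per S n p <-> (d %| n)%N.
Proof.
move=> [d0 pd dmin]; split=> [pn|/dvdnP[k ->]]; last first.
  by rewrite /Per /= (iter_modn _ pd) modnMl.
apply: contraT; rewrite /dvdn -lt0n => r0.
have: (d <= n %% d)%N by apply: dmin => //; rewrite /Per /= -iter_modn.
by rewrite leqNgt ltn_mod d0.
Qed.

(** If [S ^ i p = S ^ j p] with [i < j < d], applying [S ^ (d - j)] yields the
    period [d - j + i < d]. *)
Lemma orbit_segment_inj (p : X) (d : nat) : is_prime_period S p d ->
  set_inj `I_d (fun j => iter j S p).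
Proof.
move=> [d0 pd dmin].
have no_collision i j : (i < j < d)%N -> iter i S p = iter j S p -> False.
  move=> /andP[ij jd] eij.
  suff: (d <= d - j + i)%N.
    by rewrite leqNgt -{2}(subnK (ltnW jd)) ltn_add2l ij.
  apply: dmin; first by rewrite addn_gt0 subn_gt0 jd.
  by rewrite /Per /= iterD eij -iterD subnK ?(ltnW jd).
move=> i j; rewrite !inE /= => id jd eij.
case: (ltngtP i j) => // [ij|ji]; exfalso.
- by apply: (no_collision i j) => //; rewrite ij.
- by apply: (no_collision j i) => //; rewrite ji.
Qed.

Lemma orbit_segment_self (d : nat) (p : X) :
  (1 <= d)%N -> orbit_segment S d p p.
Proof. by move=> d0; exists 0%N. Qed.

Lemma orbit_segment_iter (d j : nat) (p : X) : (1 <= d)%N -> Per S d p ->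
  orbit_segment S d (iter j S p) = orbit_segment S d p.
Proof.
move=> d0.
have sub q k : Per S d q ->
    orbit_segment S d (iter k S q) `<=` orbit_segment S d q.
  move=> qd _ [i _ <-]; exists ((i + k) %% d)%N; first by rewrite /= ltn_mod.
  by rewrite -iter_modn// iterD.
move=> pd; apply/seteqP; split; first exact: sub.
rewrite -{1}(iter_periodic_inv j d0 pd); apply: sub; exact: Per_iter.
Qed.

End PeriodicOrbits.

(** * Sums over periodic points and over closed orbits *)

Section PeriodicSums.
Variables (R : realType) (X : choiceType) (S : X -> X) (f : X -> R).
Local Open Scope ereal_scope.

Let weight (n : nat) (p : X) : \bar R := (expR (ergodic_sum S f n p))%:E.

Let weight_ge0 n p : 0 <= weight n p.
Proof. by rewrite lee_fin expR_ge0. Qed.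

Lemma C_sum_ge0 (n : nat) : 0 <= C_sum S f n.
Proof. by apply: esum_ge0 => tau _; rewrite lee_fin expR_ge0. Qed.

(** A closed orbit of length [d] is enumerated without repetition by [`I_d], and
    the ergodic sum is constant on it.  The [d] equal terms are left as a finite
    sum so that it can be exchanged with the sum over all closed orbits. *)
Lemma esum_closed_orbit (d : nat) (tau : set X) : closed_orbits S d tau ->
  \esum_(p in tau) weight d p =
  \sum_(j < d) (expR (orbit_ergodic_sum S f d tau))%:E.
Proof.
move=> Otau; have [p pd ptau] := Otau.
rewrite (eq_esum (b := cst (expR (orbit_ergodic_sum S f d tau))%:E)); last first.
  by move=> q tauq; rewrite /weight (orbit_ergodic_sumE f Otau tauq).
rewrite -{1}ptau /orbit_segment esum_image; last exact: orbit_segment_inj.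
rewrite esum_fset//; last by move=> i _; rewrite lee_fin expR_ge0.
by rewrite -fsbig_ord.
Qed.

(** The points of prime period [d] correspond to the pairs of a closed orbit of
    length [d] and a point on it. *)
Lemma esum_prime_period (d : nat) :
  \esum_(p in [set p | is_prime_period S p d]) weight d p =
  d%:R%:E * C_sum S f d.
Proof.
transitivity (\esum_(tau in closed_orbits S d) \esum_(p in tau) weight d p).
  rewrite esum_esum//.
  rewrite (@reindex_esum _ _ _ [set p | is_prime_period S p d] _
    (fun p => (orbit_segment S d p, p)))//; split.
  - move=> p pd; split; first by exists p.
    by have [d0 _ _] := pd; exact: orbit_segment_self.
  - by move=> p q _ _ [].
  - move=> [tau q] /= [[p pd <-]] [j _ <-].
    exists (iter j S p); first exact: is_prime_period_iter.
    by have [d0 pp _] := pd; rewrite (orbit_segment_iter _ d0 pp).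
rewrite (eq_esum (fun tau => @esum_closed_orbit d tau)) esum_sum; last first.
  by move=> tau j _ _; rewrite lee_fin expR_ge0.
by rewrite sumr_const card_ord mule_natl.
Qed.

(** The points fixed by [S ^ n] are split according to their prime period, which
    ranges over the divisors of [n]. *)
Lemma E_sum_divisors (n : nat) : (1 <= n)%N ->
  E_sum S f n = \sum_(1 <= d < n.+1 | (d %| n)%N) d%:R%:E * C_sum S f d.
Proof.
move=> n0; under [RHS]eq_bigr do rewrite -esum_prime_period.
rewrite /E_sum.
transitivity (\esum_(p in Per S n) \sum_(1 <= d < n.+1 | (d %| n)%N)
    if p \in [set p | is_prime_period S p d] then weight d p else 0).
  apply: eq_esum => p pn.
  have [d pd] := is_prime_period_exists n0 pn.
  have dn : (d %| n)%N by apply/(Per_dvdn _ pd).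
  have [d0 _ _] := pd.
  rewrite big_mkcond (bigD1_seq d)/= ?iota_uniq//; last first.
    by rewrite mem_index_iota d0 ltnS dvdn_leq.
  rewrite dn mem_set// (prime_periodE pd) big1 ?adde0// => e ed.
  case: ifP => // _; rewrite memNset// => /(is_prime_period_unique pd) de.
  by rewrite de eqxx in ed.
rewrite esum_sum; last by move=> p d _ _; case: ifP.
apply: eq_bigr => d dn; rewrite -esum_mkcondr; congr esum.
by apply/setIidPr => p pd; apply/(Per_dvdn _ pd).
Qed.

Lemma mul_C_sum_le_E_sum (n : nat) : (1 <= n)%N ->
  n%:R%:E * C_sum S f n <= E_sum S f n.
Proof.
move=> n0; rewrite E_sum_divisors// big_mkcond big_nat_recr//= dvdnn leeDr//.
apply: sume_ge0 => d _; case: ifP => // _.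
by rewrite mule_ge0 ?lee_fin ?C_sum_ge0.
Qed.

Lemma E_sum_le_mul_pi_sum (n : nat) : (1 <= n)%N ->
  E_sum S f n <= n%:R%:E * pi_sum S f n.
Proof.
move=> n0; rewrite E_sum_divisors// /pi_sum ge0_sume_distrr; last first.
  by move=> d _; exact: C_sum_ge0.
rewrite big_mkcond big_nat [leRHS]big_nat; apply: lee_sum => d /andP[_ dn].
case: ifP => _; last by rewrite mule_ge0 ?lee_fin ?C_sum_ge0.
by rewrite lee_wpmul2r ?C_sum_ge0// lee_fin ler_nat.
Qed.

End PeriodicSums.

(** * Growth of [\sum_(n <= N) lam ^ n / n] *)

(** Dropping the denominators leaves a geometric sum. *)
Lemma sum_geometric_over_index_le_geometric (R : realFieldType) (lam : R)
    (N : nat) : 1 < lam ->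
  (lam - 1) * (\sum_(1 <= n < N.+1) lam ^+ n / n%:R) <= lam ^+ N.+1.
Proof.
move=> lam_gt1; have lam0 : 0 < lam by lra.
elim: N => [|N IH]; first by rewrite big_geq// mulr0 exprn_ge0 ?ltW.
rewrite big_nat_recr//= mulrDr.
have le_pow : lam ^+ N.+1 / N.+1%:R <= lam ^+ N.+1.
  rewrite ler_pdivrMr ?ltr0n//; apply: ler_peMr; last by rewrite ler1n.
  by rewrite exprn_ge0 ?ltW.
have : (lam - 1) * (lam ^+ N.+1 / N.+1%:R) <= (lam - 1) * lam ^+ N.+1.
  by rewrite ler_wpM2l// subr_ge0 ltW.
move: IH; rewrite [lam ^+ N.+2]exprS.
set U := \sum_(1 <= _ < _) _; set p := lam ^+ N.+1; set q := p / _.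
by lra.
Qed.

(** Writing [U N] for the sum,
    [N.+1 * U N.+1 = N * U N + U N + lam ^ N.+1], and the preceding lemma bounds
    [U N] by [lam ^ N.+1 / (lam - 1)]; so [N * U N] grows at most like a
    geometric sum. *)
Lemma sum_geometric_over_index_le (R : realFieldType) (lam : R) (N : nat) :
  1 < lam ->
  (lam - 1) ^+ 2 * (N%:R * \sum_(1 <= n < N.+1) lam ^+ n / n%:R)
  <= lam ^+ N.+2.
Proof.
move=> lam_gt1; have lam0 : 0 < lam by lra.
elim: N => [|N IH]; first by rewrite mul0r mulr0 exprn_ge0 ?ltW.
rewrite big_nat_recr//= mulrDr [N.+1%:R * (_ / _)]mulrCA.
rewrite divff ?pnatr_eq0// mulr1 -natr1.
have := sum_geometric_over_index_le_geometric N lam_gt1.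
move: IH; rewrite !exprS expr0 mulr1.
set U := \sum_(1 <= _ < _) _; set l := lam ^+ N => IH leU.
have : (lam - 1) * ((lam - 1) * U) <= (lam - 1) * (lam * l).
  by rewrite ler_wpM2l// subr_ge0 ltW.
by lra.
Qed.

(** * Asymptotics *)

Lemma asymp_pi_sum (R : realType) (X : choiceType) (S : X -> X) (f : X -> R)
    (lam : R) : 1 < lam ->
  asymp (E_sum S f) (fun n => lam ^+ n) ->
  asymp (pi_sum S f) (fun N => lam ^+ N / N%:R).
Proof.
move=> lam1 [k1 [k2 [k10 k20 Ef]]].
have lam0 : 0 < lam by lra.
exists k1, (k2 * (lam / (lam - 1)) ^+ 2); split=> //.
  by rewrite mulr_gt0// exprn_gt0// divr_gt0// subr_gt0.
move=> N N0; have N0R : 0 < N%:R :> R by rewrite ltr0n.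
split.
  rewrite mulrA mulrC EFinM lee_pdivrMl//.
  exact: le_trans (Ef N N0).1 (E_sum_le_mul_pi_sum _ _ N0).
apply: (@le_trans _ _ (\sum_(1 <= n < N.+1) (k2 * (lam ^+ n / n%:R))%:E)%E).
  rewrite /pi_sum big_nat [leRHS]big_nat; apply: lee_sum => n /andP[n0 _].
  rewrite mulrA mulrC EFinM lee_pdivlMl ?ltr0n//.
  exact: le_trans (mul_C_sum_le_E_sum _ _ n0) (Ef n n0).2.
rewrite sumEFin lee_fin -mulr_sumr -mulrA ler_pM2l//.
have lamB1 : 0 < lam - 1 by rewrite subr_gt0.
have -> : (lam / (lam - 1)) ^+ 2 * (lam ^+ N / N%:R) =
    lam ^+ N.+2 / ((lam - 1) ^+ 2 * N%:R).
  by rewrite !exprS; field; rewrite !gt_eqF.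
rewrite ler_pdivlMr ?mulr_gt0 ?exprn_gt0// mulrC -mulrA.
exact: sum_geometric_over_index_le.
Qed.

Theorem theorem2p2 (R : realType) (M : nat) (Q : 'I_M -> rational_map R)
    (Qdeg : exists i : 'I_M, (2 <= rdegree (Q i))%N)
    (f : words M * riemann_sphere R -> R)
    (lam : R) (lam_gt1 : 1 < lam)
    (Ef : asymp (E_sum (skew_product Q) f) (fun n => lam ^+ n)) :
  asymp (pi_sum (skew_product Q) f) (fun N => lam ^+ N / N%:R).
Proof. exact: asymp_pi_sum lam_gt1 Ef. Qed.
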